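(* All extraspecial $2$-groups except the quaternion group $Q_2$ of order $8$ are strongly real: every extraspecial $2$-group not isomorphic to $Q_2$ is strongly real, while $Q_2$ is not strongly real.
   Context: A finite $2$-group $G$ is special if it is non-commutative and $G' = \Phi(G) = Z(G) = \Omega(Z(G))$, where $G'=[G,G]$, $\Phi(G)$ is the Frattini subgroup, and $\Omega(H)=\langle x\in H : x^2=1\rangle$. A special $2$-group $G$ with $|Z(G)|=2$ is called extraspecial. $Q_2=\langle c,d : c^4=1, d^2=c^2, dcd^{-1}=c^{-1}\rangle$ is the quaternion group of order $8$. An element of a group is strongly real if it is a product of two elements each equal to its own inverse (i.e. elements $y$ with $y^2=1$, the identity allowed); equivalently, $x$ is strongly real if there is $y$ in the group with $y^2=1$ and $y^{-1}xy=x^{-1}$. A group is strongly real if all its elements are. *)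

(* Defs.v *)
From mathcomp Require Import all_boot all_fingroup all_solvable.

Set Implicit Arguments.
Unset Strict Implicit.
Unset Printing Implicit Defensive.

Local Open Scope group_scope.

(* The subgroup generated by the x in A with x^2 = 1. The library's 'Ohm_1
   agrees with it on 2-groups but not in general. *)
Definition Omega2 (gT : finGroupType) (A : {set gT}) : {set gT} :=
  <<[set x in A | x ^+ 2 == 1]>>.

(* Unlike the library's [special], this excludes the trivial group and fixes
   the prime 2. *)
Definition special2 (gT : finGroupType) (G : {set gT}) : Prop :=
  [/\ 2.-group G, ~~ abelian G, G^`(1) = 'Phi(G), 'Phi(G) = 'Z(G)
    & 'Z(G) = Omega2 'Z(G)].

Definition extraspecial2 (gT : finGroupType) (G : {set gT}) : Prop :=
  special2 G /\ #|'Z(G)| = 2.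

Definition strongly_real_elt (gT : finGroupType) (G : {set gT}) (x : gT) :
    Prop :=
  exists y z : gT,
    [/\ y \in G, z \in G, y ^+ 2 = 1, z ^+ 2 = 1 & x = y * z].

Definition strongly_real (gT : finGroupType) (G : {set gT}) : Prop :=
  forall x : gT, x \in G -> strongly_real_elt G x.

Lemma strongly_real_eltP (gT : finGroupType) (G : {group gT}) (x : gT) :
  x \in G ->
  (strongly_real_elt G x <->
   exists y : gT, [/\ y \in G, y ^+ 2 = 1 & y^-1 * x * y = x^-1]).
Proof.
have invE (u : gT) : u ^+ 2 = 1 -> u^-1 = u.
  by move=> u2; apply: (mulgI u); rewrite mulgV -expg2 u2.
move=> Gx; split=> [[y [z [Gy Gz y2 z2 ->]]]|[y [Gy y2 xy]]].
  by exists y; split; rewrite // invMg (invE y) // (invE z) // mulgA -expg2 y2 mul1g.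
exists y, (y^-1 * x); split; rewrite ?groupM ?groupV ?mulKVg //.
by rewrite expg2 mulgA -{2}(invE y y2) invgK xy mulVg.
Qed.

Lemma extraspecial2P (gT : finGroupType) (G : {group gT}) :
  extraspecial2 G <-> 2.-group G /\ extraspecial G.
Proof.
split=> [[[pG _ dG PG _] oZ]|[pG esG]].
  by split=> //; split; rewrite ?oZ // /special -PG.
have oZ := card_center_extraspecial pG esG.
have nabG := extraspecial_nonabelian esG.
case: esG => [[PhiG derG] _]; split=> //; split=> //; first by rewrite derG.
rewrite /Omega2 -[LHS]genGid; congr <<_>>; apply/setP=> x.
rewrite [RHS]inE andb_idr // => Zx.
by rewrite -order_dvdn -oZ order_dvdG.
Qed.

(* The group <c, d | c^4 = 1, d^2 = c^2, d c d^-1 = c^-1> is the library's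
   'Q_8, whose presentation has c ^ d = d^-1 c d instead of d c d^-1. *)
Lemma Q8_presentation :
  'Q_8 \isog Grp (c : d : c ^+ 4, d ^+ 2 = c ^+ 2, d * c * d^-1 = c^-1).
Proof.
move=> rT H; rewrite (@Grp_quaternion 3) //.
apply: eq_existsb => -[c d] /=; rewrite !xpair_eqE; do 3!congr (_ && _).
rewrite (can2_eq (conjgK d) (conjgKV d)) conjVg -eq_invg_sym.
by rewrite conjgE invgK mulgA eq_sym.
Qed.

(* Main.v *)
Require Import Defs.
From mathcomp Require Import all_boot all_fingroup all_solvable.

(** Let [x] be an element of an extraspecial 2-group [G] with [Z(G) = {1, z}]
    that is not strongly real, so that [x ^+ 2 = z] and [y ^+ 2 = z] for every
    [y] not commuting with [x].  Fix such a [y].  If [w] centralizes [x] and [y]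
    then [y * w] does not commute with [x] either, so [w ^+ 2 = 1].  The
    centralizer of [{x, y}] therefore has exponent 2, hence is abelian; as it
    generates [G] together with [x] and [y], it is central.  Thus [G] is
    generated by [x] and [y], and these satisfy the relations of ['Q_8]. *)

Set Implicit Arguments.
Unset Strict Implicit.

Local Open Scope group_scope.

Lemma extraspecial2_centerP (gT : finGroupType) (G : {group gT}) :
    extraspecial2 G ->
  exists z, [/\ 'Z(G) = [set 1; z], z ^+ 2 = 1,
    {in G &, forall a b, a ^ b = a \/ a ^ b = a * z}
    & {in G, forall a, a ^+ 2 = 1 \/ a ^+ 2 = z}].
Proof.
case=> -[pG _ derG PhiG _] oZ.
have [z Zz nz1] : exists2 z, z \in 'Z(G) & z != 1.
  by apply/trivgPn; rewrite -cardG_gt1 oZ.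
have defZ : 'Z(G) = [set 1; z].
  apply/esym/eqP; rewrite eqEcard subUset !sub1set group1 Zz oZ cards2.
  by rewrite eq_sym nz1.
have Z2 a : a \in 'Z(G) -> a = 1 \/ a = z.
  by rewrite defZ => /set2P.
exists z; split=> // [|a b Ga Gb|a Ga].
- by apply/eqP; rewrite -order_dvdn -oZ order_dvdG.
- have /Z2[ab|ab]: [~ a, b] \in 'Z(G) by rewrite -PhiG -derG mem_commg.
    by left; apply/conjg_fixP/eqP.
  by right; rewrite -ab commgEl mulKVg.
- apply: Z2; rewrite -PhiG (Phi_joing pG); apply: subsetP (joing_subr _ _) _ _.
  by apply: (Mho_p_elt 1) => //; apply: mem_p_elt pG Ga.
Qed.

Section NonReal.

Variables (gT : finGroupType) (G : {group gT}) (z x : gT).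
Hypotheses (defZ : 'Z(G) = [set 1; z]) (z2 : z ^+ 2 = 1).
Hypothesis conjG : {in G &, forall a b, a ^ b = a \/ a ^ b = a * z}.
Hypothesis sqrG : {in G, forall a, a ^+ 2 = 1 \/ a ^+ 2 = z}.
Hypotheses (Gx : x \in G) (xz : x ^+ 2 = z).
Hypothesis xI : {in G, forall y, y ^+ 2 = 1 -> x ^ y = x}.

Lemma conj_center b : b \in G -> z ^ b = z.
Proof.
move=> Gb; have /centerP[_ cz] : z \in 'Z(G) by rewrite defZ set22.
by rewrite conjgE (cz b Gb) mulKg.
Qed.

Lemma conjM_fix a b g :
    a \in G -> b \in G -> g \in G -> a ^ b <> a -> a ^ g <> a ->
  a ^ (b * g) = a.
Proof.
move=> Ga Gb Gg nab nag.
have [//|ab] := conjG Ga Gb; have [//|ag] := conjG Ga Gg.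
by rewrite conjgM ab conjMg ag conj_center // -mulgA -expg2 z2 mulg1.
Qed.

Lemma sqr_nonfix y : y \in G -> x ^ y <> x -> y ^+ 2 = z.
Proof. by move=> Gy nxy; case: (sqrG Gy) => // /(xI Gy). Qed.

Section Generators.

Variable y : gT.
Hypotheses (Gy : y \in G) (nxy : x ^ y <> x).

Lemma nonfix_sym : y ^ x <> y.
Proof. by move/conjg_fixP/commgP/commute_sym/commgP/conjg_fixP. Qed.

Lemma sqr_cent_pair w : w \in G -> x ^ w = x -> y ^ w = y -> w ^+ 2 = 1.
Proof.
move=> Gw xw yw; have cyw : commute y w by apply/commgP/conjg_fixP.
have nxyw : x ^ (y * w) <> x.
  by move=> xyw; apply: nxy; apply: (conjg_inj w); rewrite -conjgM xyw xw.
have := sqr_nonfix (groupM Gy Gw) nxyw.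
by rewrite expgMn // (sqr_nonfix Gy nxy) -[RHS]mulg1 => /mulgI.
Qed.

(** Every coset of the subgroup generated by [x] and [y] meets the centralizer of both: a factor [y]
    corrects the action on [x], then a factor [x] corrects the action on [y] without disturbing
    [x]. *)
Lemma cent_pair_translate g : g \in G ->
  exists2 q, q \in <[x]> <*> <[y]> & x ^ (q * g) = x /\ y ^ (q * g) = y.
Proof.
have Qx : x \in <[x]> <*> <[y]> by rewrite mem_gen // inE cycle_id.
have Qy : y \in <[x]> <*> <[y]> by rewrite mem_gen // inE cycle_id orbT.
move=> Gg.
have [q Qq [Gq xq]]: exists2 q, q \in <[x]> <*> <[y]> & q \in G /\ x ^ (q * g) = x.
  have [xg|/eqP nxg] := eqVneq (x ^ g) x; first by exists 1; rewrite ?group1 // mul1g.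
  by exists y => //; split=> //; apply: conjM_fix.
have [yq|/eqP nyq] := eqVneq (y ^ (q * g)) y; first by exists q.
exists (x * q); first exact: groupM.
rewrite -!mulgA; split; first by rewrite conjgM (conjgE x x) mulKg.
by apply: conjM_fix; rewrite ?groupM //; apply: nonfix_sym.
Qed.

Lemma cent_pair_center w : w \in G -> x ^ w = x -> y ^ w = y -> w \in 'Z(G).
Proof.
move=> Gw xw yw; apply/centerP; split=> // g Gg.
have cwQ : <[x]> <*> <[y]> \subset 'C[w].
  rewrite join_subG !cycle_subG.
  by apply/andP; split; apply/cent1P/commgP/conjg_fixP.
have [q Qq [xqg yqg]] := cent_pair_translate Gg.
have sQG : <[x]> <*> <[y]> \subset G by rewrite join_subG !cycle_subG Gx.
have Gqg : q * g \in G by rewrite groupM // (subsetP sQG).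
have invE (u : gT) : u ^+ 2 = 1 -> u^-1 = u.
  by move=> u2; apply: (mulgI u); rewrite mulgV -expg2 u2.
(* [w], [q * g] and their product all centralize [x] and [y], so all three are their own inverses,
   which forces the two factors to commute. *)
have cwqg : commute w (q * g).
  have wqg2 : (w * (q * g)) ^+ 2 = 1.
    by apply: sqr_cent_pair; rewrite ?(groupM Gw) // conjgM ?xw ?yw.
  rewrite /commute -[LHS](invE _ wqg2) invMg.
  by rewrite (invE w) ?(invE (q * g)) //; apply: sqr_cent_pair.
have cwq : commute w q by apply/commute_sym/cent1P/(subsetP cwQ).
rewrite -[g](mulKg q); apply: commuteM => //.
exact: commuteV.
Qed.

(** A translate [q * g] centralizing [x] and [y] is central, hence [1] or [z = x ^+ 2], and so
    already lies in the subgroup they generate. *)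
Lemma cent_pair_generate : <[x]> <*> <[y]> = G.
Proof.
apply/eqP; rewrite eqEsubset join_subG !cycle_subG Gx Gy /=.
apply/subsetP=> g Gg; have [q Qq [xqg yqg]] := cent_pair_translate Gg.
have Gq : q \in G.
  by apply: subsetP Qq; rewrite join_subG !cycle_subG Gx.
rewrite -(groupMl g Qq).
have := cent_pair_center (groupM Gq Gg) xqg yqg.
rewrite defZ => /set2P[->|->]; first exact: group1.
by rewrite -xz groupX // mem_gen // inE cycle_id.
Qed.

End Generators.

Lemma nonreal_isog_Q8 : 8 <= #|G| -> x \notin 'Z(G) -> G \isog 'Q_8.
Proof.
move=> G8 nZx.
have [y Gy nxy] : exists2 y, y \in G & x ^ y <> x.
  have: ~~ (G \subset 'C[x]) by rewrite sub_cent1; apply: contra nZx => cGx; apply/setIP.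
  case/subsetPn=> y Gy ncxy; exists y => // /conjg_fixP/commgP cxy.
  by case/cent1P: ncxy.
(* The order bound leaves only a surjection from ['Q_8] to find, which the presentation provides. *)
rewrite isogEcard (@card_quaternion 3) // G8 andbT (@Grp_quaternion 3) //.
apply/existsP; exists (x, y) => /=.
rewrite !xpair_eqE cent_pair_generate // eqxx (expgM x 2 2) xz z2 eqxx /=.
rewrite (sqr_nonfix Gy nxy) eqxx /=.
(* [x * z = x ^+ 3 = x^-1], since [x ^+ 4 = 1]. *)
have [//|->] := conjG Gx Gy.
by rewrite eq_sym eq_invg_mul -xz -expgS -expgS (expgM x 2 2) xz z2.
Qed.

End NonReal.

Theorem proposition3p8 :
  (forall (gT : finGroupType) (G : {group gT}),
      extraspecial2 G -> ~ (G \isog 'Q_8) -> strongly_real G)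
  /\ ~ strongly_real 'Q_8.
Proof.
split=> [gT G esG nQ x Gx|realQ].
  have [z [defZ z2 conjG sqrG]] := extraspecial2_centerP esG.
  have [x2|nx2] := eqVneq (x ^+ 2) 1.
    by exists x, 1; rewrite group1 mulg1 expg1n.
  have [xz|xz] := sqrG _ Gx; first by rewrite xz eqxx in nx2.
  apply/(strongly_real_eltP Gx).
  (* A square root [y] of 1 that moves [x] sends it to [x * z = x^-1], so it inverts [x]. If there
     is none, [G] is forced to be ['Q_8]. *)
  have [/existsP[y /and3P[Gy /eqP y2 /eqP nxy]]|] :=
      boolP [exists y, [&& y \in G, y ^+ 2 == 1 & x ^ y != x]].
    exists y; split=> //; rewrite -mulgA -conjgE.
    have [//|->] := conjG _ _ Gx Gy.
    by apply/eqP; rewrite eq_sym eq_invg_mul -xz -!expgS (expgM x 2 2) xz z2.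
  rewrite negb_exists => /forallP noy; case: nQ.
  have /extraspecial2P[pG eG] := esG.
  apply: (nonreal_isog_Q8 defZ z2 conjG sqrG Gx xz).
  - move=> y Gy y2; apply/eqP; have := noy y.
    by rewrite Gy y2 eqxx /= negbK.
  - exact: min_card_extraspecial pG eG.
  - apply: contra nx2; rewrite defZ => /set2P[->|->]; first by rewrite expg1n.
    by rewrite z2.
have isoQ : 'Q_8 \isog 'Q_(2 ^ 3) by apply: isog_refl.
have [[x y] genQ _] := generators_quaternion (isT : 2 < 3) isoQ.
have [_ _ [defZ _ inv_uniq _ _] _ _] := quaternion_structure (isT : 2 < 3) genQ isoQ.
(* The only involution of ['Q_8] generates its center, so strongly real elements are central; if all
   were, ['Q_8] would be abelian. *)
have invZ u : u \in 'Q_8 -> u ^+ 2 = 1 -> u \in 'Z('Q_8).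
  move=> Qu /eqP u2; have [->|nu1] := eqVneq u 1; first exact: group1.
  rewrite defZ [u]inv_uniq ?cycle_id //; exact: nt_prime_order (eqP u2) nu1.
have /negP[] := extraspecial_nonabelian Q8_extraspecial.
apply: subset_trans (subsetIr 'Q_8 _); apply/subsetP=> _ /realQ[a [b [Qa Qb a2 b2 ->]]].
by rewrite groupM ?invZ.
Qed.
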